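(* Assume (A.1) and (A.2). Then, for any $\beta\in(0,1)$ there is $\gamma_0<0$ such that, for any $\gamma\in[\gamma_0,0]$, the first constituent $\hat u^\beta_0=\hat u^{\beta}_0(\cdot\,;\gamma)$ of the Bellman-induced Markov policy $\hat\pi^\beta$ is (as a stationary Markov policy) optimal for the risk-neutral discounted problem, that is, $\hat u^\beta_0\in\Pi^*(\beta,0)$.
   Context: Setting (finite discounted risk-sensitive MDP). $E=\{x_1,\dots,x_k\}$ is a finite state space and $U=\{\tilde u_1,\dots,\tilde u_l\}$ a finite action space (both nonempty); every action is available in every state. For $a\in U$, $P^a=[p_a(x_i,x_j)]$ is a transition probability matrix and $\mathbb{P}^a(x,A):=\sum_{y\in A}p_a(x,y)$ for $A\subset E$ (with $\mathbb{P}^a(x,y):=\mathbb{P}^a(x,\{y\})$). $c\colon E\times U\to\mathbb{R}$ is a fixed running reward. $(X_n)_{n\ge0}$ is the state process. A policy is a sequence $\pi=(a_n)_{n\ge0}$, $a_n$ a $U$-valued function of $(X_0,\dots,X_n)$; $\Pi$ is the set of all policies. $\mathbb{E}_x^\pi$ is expectation under the law with $X_0=x$ and $\mathbb{P}(X_{n+1}=y\mid X_0,\dots,X_n)=p_{a_n}(X_n,y)$. $\Pi''\subset\Pi$ is the set of Markov policies: $a_n=u_n(X_n)$ with $u_n\colon E\to U$; stationary Markov policies ($\Pi'$) are those with $u_n=u$ for all $n$, identified with $u\colon E\to U$. $\mathbb{P}^{(\pi,n)}(x,y)$ is the probability under $\pi$ that $X_n=y$ given $X_0=x$. Criterion: $J_\gamma(x,\pi;\beta):=\frac1\gamma\ln\mathbb{E}_x^\pi\big[e^{\gamma\sum_{i=0}^\infty\beta^ic(X_i,a_i)}\big]$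 if $\gamma\ne0$, $J_0(x,\pi;\beta):=\mathbb{E}_x^\pi\big[\sum_{i=0}^\infty\beta^ic(X_i,a_i)\big]$; $w^\beta(x,\gamma):=\sup_{\pi\in\Pi}J_\gamma(x,\pi;\beta)$; $\Pi^*(\beta,\gamma)$ is the set of $\pi\in\Pi''$ with $J_\gamma(x,\pi;\beta)=w^\beta(x,\gamma)$ for all $x\in E$. Bellman-induced policy: for given $\gamma\in\mathbb{R}$, $\hat\pi^\beta=(\hat u_0^\beta,\hat u_1^\beta,\dots)$, where for $i\ge0$ $$\hat u_i^\beta(x):=\begin{cases}\arg\max_{a\in U}\big[c(x,a)+\frac1{\gamma\beta^i}\ln\big(\sum_{y\in E}e^{\gamma\beta^{i+1}w^\beta(y,\gamma\beta^{i+1})}\mathbb{P}^a(x,y)\big)\big],&\gamma\ne0,\\ \arg\max_{a\in U}\big[c(x,a)+\sum_{y\in E}\beta w^\beta(y,0)\mathbb{P}^a(x,y)\big],&\gamma=0,\end{cases}$$ choosing the maximiser with the smallest index in $U=\{\tilde u_1,\dots,\tilde u_l\}$ in case of ties. Assumptions. (A.1) $\overline\Delta:=\sup_{x,x'\in E}\sup_{A\subset E}\sup_{a,a'\in U}|\mathbb{P}^a(x,A)-\mathbb{P}^{a'}(x',A)|<1$. (A.2) There exists $N\in\mathbb{N}$ such that $K:=\sup_{x,x'\in E}\sup_{y\in E}\sup_{\pi\in\Pi''}\frac{\mathbb{P}^{(\pi,N)}(x,y)}{\mathbb{P}^{(\pi,N)}(x',y)}<\infty$, with conventions $0/0:=1$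 and $p/0:=\infty$ for $p>0$. *)

(* Defs.v *)
From HB Require Import structures.
From mathcomp Require Import all_boot all_order all_algebra.
From mathcomp Require Import all_classical all_reals all_analysis.
Import Order.TTheory GRing.Theory Num.Theory.
Import numFieldNormedType.Exports.

Set Implicit Arguments.
Unset Strict Implicit.
Unset Printing Implicit Defensive.

Local Open Scope classical_set_scope.
Local Open Scope ring_scope.

(* [trans M a x y] is p_a(x, y).  The last two fields only record that both
   spaces are nonempty.  The actions are ordered by [enum U]. *)
Record mdp (R : realType) (E U : finType) := Mdp {
  trans : U -> E -> E -> R;
  reward : E -> U -> R;
  trans_ge0 : forall a x y, 0 <= trans a x y;
  trans_sum1 : forall a x, \sum_y trans a x y = 1;
  some_state : E;
  some_action : U
}.

Definition trans_set (R : realType) (E U : finType) (M : mdp R E U)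
    (a : U) (x : E) (A : {set E}) : R :=
  \sum_(y in A) trans M a x y.

(* [pi n h] is the action a_n chosen after the history h = (X_0, ..., X_n). *)
Definition policy (E U : finType) := forall n, n.+1.-tuple E -> U.

Definition hist (E : finType) (w : nat -> E) (n : nat) : n.+1.-tuple E :=
  [tuple w i | i < n.+1].

Definition markov (E U : finType) (u : nat -> E -> U) : policy E U :=
  fun n h => u n (tnth h ord_max).

Definition is_markov (E U : finType) (pi : policy E U) : Prop :=
  exists u : nat -> E -> U, pi = markov u.

Definition stationary (E U : finType) (u : E -> U) : policy E U :=
  markov (fun=> u).

(* Trajectories.  The argument [M] only serves to provide the point which the
   library requires of a measurable type. *)
Definition traj (R : realType) (E U : finType) (M : mdp R E U) : Type :=
  nat -> E.
HB.instance Definition _ R E U M := Choice.on (@traj R E U M).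
HB.instance Definition _ R E U M :=
  isPointed.Build (@traj R E U M) (fun=> some_state M).

Definition coord_events (R : realType) (E U : finType) (M : mdp R E U) :
    set (set (traj M)) :=
  [set B | exists n y, B = [set w : traj M | w n = y]].
Arguments coord_events {R E U} M.

Definition traj_space (R : realType) (E U : finType) (M : mdp R E U) :=
  g_sigma_algebraType (coord_events M).

Definition is_traj_law (R : realType) (E U : finType) (M : mdp R E U)
    (pi : policy E U) (x : E) (P : probability (traj_space M) R) : Prop :=
  P [set w | w 0%N = x] = 1%E /\
  forall n (h : n.+1.-tuple E) (y : E),
    P ([set w | hist w n = h] `&` [set w | w n.+1 = y]) =
    (P [set w | hist w n = h] * (trans M (pi n h) (tnth h ord_max) y)%:E)%E.

Lemma image_probability (R : realType) (d d' : measure_display)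
    (S : measurableType d) (T : measurableType d')
    (P : probability S R) (X : S -> T) (mX : measurable_fun setT X) :
  exists Q : probability T R, forall A, Q A = P (X @^-1` A).
Proof.
pose X' : {mfun S >-> T} := mfun_Sub (mem_set mX).
by exists (distribution P X').
Qed.

(* Existence of the law: [0, 1) is cut recursively into intervals [I w n] whose
   lengths are the probabilities of the finite histories, and the state process
   is read off a uniformly distributed point. *)
Section traj_law_construction.
Variables (R : realType) (E U : finType) (M : mdp R E U).
Variables (pi : policy E U) (x : E).
Implicit Types (w v : nat -> E) (n k : nat) (g : E -> R) (s : R).

Let q w n (y : E) : R := trans M (pi (hist w n)) (w n) y.
Let cumul g k : R := \sum_(0 <= i < k) g (nth x (enum E) i).
Let rk (y : E) := index y (enum E).
Let wt w n : R := \prod_(0 <= i < n) q w i (w i.+1).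
Let lo w n : R := \sum_(0 <= i < n) wt w i * cumul (q w i) (rk (w i.+1)).
Let I w n : set R := [set s | lo w n <= s < lo w n + wt w n].
Let agree w v n := forall i, (i <= n)%N -> w i = v i.

Let histP w v n : hist w n = hist v n <-> agree w v n.
Proof.
split=> [h i le_in|h]; last first.
  by apply: eq_from_tnth => i; rewrite !tnth_mktuple h // -ltnS.
have := congr1 (fun t => tnth t (Ordinal (le_in : (i < n.+1)%N))) h.
by rewrite !tnth_mktuple.
Qed.

Let agreeW w v n k : (k <= n)%N -> agree w v n -> agree w v k.
Proof. by move=> kn h i ik; apply: h; apply: leq_trans kn. Qed.

Let q_agree w v n : agree w v n -> q w n = q v n.
Proof.
by move=> h; apply/funext => y; rewrite /q (iffRL (histP w v n) h) (h n).
Qed.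

Let wt_agree w v n : agree w v n -> wt w n = wt v n.
Proof.
move=> h; apply: eq_big_nat => i /andP[_ lt_in].
by rewrite (q_agree (agreeW (ltnW lt_in) h)) (h i.+1).
Qed.

Let lo_agree w v n : agree w v n -> lo w n = lo v n.
Proof.
move=> h; apply: eq_big_nat => i /andP[_ lt_in].
have hi := agreeW (ltnW lt_in) h.
by rewrite (q_agree hi) (wt_agree hi) (h i.+1).
Qed.

Let q_ge0 w n y : 0 <= q w n y. Proof. exact: trans_ge0. Qed.

Let wt_ge0 w n : 0 <= wt w n. Proof. by apply: prodr_ge0. Qed.

Let wtS w n : wt w n.+1 = wt w n * q w n (w n.+1).
Proof. by rewrite /wt big_nat_recr. Qed.

Let loS w n :
  lo w n.+1 = lo w n + wt w n * cumul (q w n) (rk (w n.+1)).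
Proof. by rewrite /lo big_nat_recr. Qed.

Let cumulS g k : cumul g k.+1 = cumul g k + g (nth x (enum E) k).
Proof. by rewrite /cumul big_nat_recr. Qed.

Let cumul_le w n i j :
  (i <= j)%N -> cumul (q w n) i <= cumul (q w n) j.
Proof.
move=> /subnK <-; elim: (j - i)%N => // k IHk.
by apply: (le_trans IHk); rewrite addSn cumulS lerDl.
Qed.

Let cumul_card w n : cumul (q w n) #|E| = 1.
Proof.
rewrite -(trans_sum1 M (pi (hist w n)) (w n)) -big_enum /=.
by rewrite (big_nth x) -cardE.
Qed.

Let step s w n y := lo w n + wt w n * cumul (q w n) (rk y) <= s <
  lo w n + wt w n * cumul (q w n) (rk y).+1.

Let I_S w n s : I w n.+1 s <-> step s w n (w n.+1).
Proof.
rewrite /I /step /= loS wtS cumulS nth_index ?mem_enum //.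
by rewrite mulrDr addrA.
Qed.

Let step_ex w n s : I w n s -> exists y, step s w n y.
Proof.
move=> /andP[le_lo lt_hi].
have: s < lo w n + wt w n * cumul (q w n) #|E| by rewrite cumul_card mulr1.
have: (#|E| <= #|E|)%N by [].
elim: {1 3}#|E| => [|k IHk] le_k lt_k.
  by move: lt_k; rewrite /cumul big_geq // mulr0 addr0 ltNge le_lo.
have [le_s|lt_s] := leP (lo w n + wt w n * cumul (q w n) k) s; last first.
  by apply: IHk => //; exact: ltnW.
exists (nth x (enum E) k).
by rewrite /step /rk index_uniq ?enum_uniq -?cardE // le_s.
Qed.

Let step_inj w n s y z : step s w n y -> step s w n z -> y = z.
Proof.
wlog le_yz : y z / (rk y <= rk z)%N.
  move=> W sy sz; have [?|/ltnW ?] := leqP (rk y) (rk z); first exact: W.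
  by apply/esym; apply: W.
move=> /andP[_ hy] /andP[hz _].
have /eqP e : rk y == rk z.
  rewrite eqn_leq le_yz leqNgt; apply/negP => lt_yz.
  have := lt_le_trans hy (lerD (lexx (lo w n))
    (ler_wpM2l (wt_ge0 w n) (cumul_le w n lt_yz))).
  by rewrite ltNge hz.
by rewrite -(nth_index x (mem_enum E y)) -/(rk y) e nth_index ?mem_enum.
Qed.

Let loS_ge w n : lo w n <= lo w n.+1.
Proof.
rewrite loS lerDl mulr_ge0 //.
by have := cumul_le w n (leq0n (rk (w n.+1))); rewrite {1}/cumul big_geq.
Qed.

Let hiS_le w n : lo w n.+1 + wt w n.+1 <= lo w n + wt w n.
Proof.
rewrite loS wtS -addrA -mulrDr lerD2l -[leRHS]mulr1 ler_wpM2l //.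
rewrite -(cumul_card w n) -[X in _ + q _ _ X](nth_index x (mem_enum E _)).
by rewrite -cumulS; apply: cumul_le; rewrite cardE index_mem mem_enum.
Qed.

Let I_anti w n s : I w n.+1 s -> I w n s.
Proof.
move=> /andP[hl hr]; apply/andP; split; first exact: le_trans hl.
exact: lt_le_trans hr (hiS_le w n).
Qed.

Let I_inj w v n s : w 0%N = v 0%N -> I w n s -> I v n s -> agree w v n.
Proof.
move=> wv0; elim: n => [|n IHn] Iw Iv; first by case.
have h := IHn (I_anti Iw) (I_anti Iv).
move=> i; rewrite leq_eqVlt => /predU1P[->|]; last exact: h.
move: Iw Iv => /I_S Iw /I_S; rewrite /step -(q_agree h) -(lo_agree h).
by rewrite -(wt_agree h) => Iv; apply: (step_inj Iw Iv).
Qed.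

Let I0 w s : I w 0 s <-> 0 <= s < 1.
Proof. by rewrite /I /= /lo /wt !big_geq // add0r. Qed.

Let I_sub w n s : I w n s -> 0 <= s < 1.
Proof. by elim: n => [/I0 //|n IHn] /I_anti. Qed.

Fixpoint traj_approx s n : nat -> E :=
  if n is m.+1 then fun i =>
    if (i <= m)%N then traj_approx s m i
    else xget x [set y | step s (traj_approx s m) m y]
  else fun=> x.

Let traj_ex s : 0 <= s < 1 -> exists w, w 0%N = x /\ forall n, I w n s.
Proof.
move=> s01; pose w i := traj_approx s i i.
have wE n : agree w (traj_approx s n) n.
  move=> i; elim: n => [|n IHn]; first by rewrite leqn0 => /eqP ->.
  rewrite leq_eqVlt => /predU1P[-> //|lt_in].
  by rewrite IHn //= -ltnS lt_in.
exists w; split=> //; elim=> [|n IHn]; first exact/I0.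
have [y sy] := step_ex IHn.
apply/I_S; have e : step s (traj_approx s n) n = step s w n.
  by rewrite /step (q_agree (wE n)) (lo_agree (wE n)) (wt_agree (wE n)).
have -> : w n.+1 = xget x [set y | step s w n y].
  by rewrite -e {1}/w /= ltnn.
by case: xgetP => [z _ //|/(_ y)].
Qed.

Let X s : traj_space M :=
  xget (fun=> x) [set w : nat -> E | w 0%N = x /\ forall n, I w n s].

Let X0 s : X s 0%N = x.
Proof. by rewrite /X; case: xgetP => // w _ []. Qed.

Let XI s n : 0 <= s < 1 -> I (X s) n s.
Proof.
move=> /traj_ex[w hw]; rewrite /X.
by case: xgetP => [v _ [_ h]|/(_ w)//]; exact: h.
Qed.

Let Xout s : ~ (0 <= s < 1) -> X s = fun=> x.
Proof.
move=> s01; rewrite /X; case: xgetP => // v _ [_ /(_ 0%N)/I0 h].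
by case: s01.
Qed.

Let event w n := [set s | hist (X s) n = hist w n].

Let outside : set R := [set s | ~ (0 <= s < 1)].

Let event_in w n : w 0%N = x -> event w n `&` ~` outside = I w n.
Proof.
move=> w0; apply/seteqP; split=> s /=.
  move=> [/histP h /contrapT /(@XI _ n)].
  by rewrite /I /= (lo_agree h) (wt_agree h).
move=> Is; have s01 := I_sub Is; split; last by apply.
by apply/histP; apply: I_inj Is; [rewrite w0 X0|exact: XI].
Qed.

Let event_out w n :
  event w n `&` outside = outside \/ event w n `&` outside = set0.
Proof.
have [h|h] := pselect (hist (fun=> x) n = hist w n); [left|right].
  apply/seteqP; split=> s; first by case.
  by move=> s01; split=> //; rewrite /event /= Xout.
by apply/seteqP; split=> s //; rewrite /event /= => -[+ s01]; rewrite Xout.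
Qed.

Let m : probability _ R := uniform_prob (@ltr01 R).

Let I_itv w n : I w n = `[lo w n, (lo w n + wt w n)[%classic.
Proof. by apply/seteqP; split=> s /=; rewrite in_itv. Qed.

Let mI w n : measurable (I w n).
Proof. by rewrite I_itv; exact: measurable_itv. Qed.

Let outsideE : outside = ~` I (fun=> x) 0.
Proof. by apply/seteqP; split=> s /= h /I0. Qed.

Let m_outside : measurable outside.
Proof. by rewrite outsideE; exact: measurableC. Qed.

Let m_event_out w n : measurable (event w n `&` outside).
Proof. by have [->|->] := event_out w n; [exact: m_outside|]. Qed.

Let event0 w n : w 0%N <> x -> event w n = set0.
Proof.
move=> w0; apply/seteqP; split=> s //= /histP /(_ 0%N (leq0n _)).
by rewrite X0 => h; apply: w0.
Qed.

Let m_event w n : measurable (event w n).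
Proof.
have [w0|w0] := pselect (w 0%N = x); last by rewrite event0.
rewrite -(setUIDK (event w n) (~` outside)) setDE setCK.
by apply: measurableU; rewrite ?event_in.
Qed.

Let lo_ge0 w n : 0 <= lo w n.
Proof.
elim: n => [|n IHn]; first by rewrite /lo big_geq.
exact: le_trans IHn (loS_ge w n).
Qed.

Let hi_le1 w n : lo w n + wt w n <= 1.
Proof.
elim: n => [|n]; first by rewrite /lo /wt !big_geq // add0r.
exact: le_trans (hiS_le w n).
Qed.

Let mI_wt w n : m (I w n) = (wt w n)%:E.
Proof.
rewrite /m /= /uniform_prob integral_uniform_pdf.
have -> : I w n `&` `[0, 1] = I w n.
  apply/setIidl => s /I_sub/andP[s0 s1] /=.
  by rewrite in_itv /= s0 ltW.
rewrite (eq_integral (fun=> 1%E)); last first.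
  move=> s /set_mem /I_sub/andP[s0 s1].
  by rewrite /uniform_pdf s0 ltW //= subr0 invr1.
rewrite integral_cst; last exact: mI.
rewrite mul1e I_itv; apply: (etrans (lebesgue_measure_itv _)).
rewrite /= lte_fin ltrDl.
case: ltP => [_|wt0]; first by rewrite -EFinD addrC addKr.
by congr _%:E; apply/eqP; rewrite eq_le wt_ge0.
Qed.

Let m_out0 : m outside = 0%E.
Proof.
rewrite outsideE probability_setC; last exact: mI.
by rewrite mI_wt /wt big_geq // subee.
Qed.

Let m_eventE w n : w 0%N = x -> m (event w n) = (wt w n)%:E.
Proof.
move=> w0.
rewrite -(setUIDK (event w n) (~` outside)) setDE setCK event_in //.
have -> : m (I w n `|` event w n `&` outside) =
    (m (I w n) + m (event w n `&` outside))%E.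
  apply: measureU; [exact: mI|exact: m_event_out|].
  apply/seteqP; split=> s // -[Is [_ out]]; exact: out (I_sub Is).
rewrite mI_wt; have [->|->] := event_out w n; first by rewrite m_out0 adde0.
by rewrite measure0 adde0.
Qed.

Let X_measurable :
  @measurable_fun _ _ (measurableTypeR R) (traj_space M) setT X.
Proof.
apply: (@measurability _ _ (measurableTypeR R) (traj_space M) setT X
  (coord_events M)) => //.
move=> _ [_ [n [y ->]] <-]; rewrite setTI.
have -> : X @^-1` [set w | w n = y] =
    \bigcup_(h in [set h : n.+1.-tuple E | tnth h ord_max = y])
      event (nth x h) n.
  have hE (h : n.+1.-tuple E) : hist (nth x h) n = h.
    by apply: eq_from_tnth => i; rewrite tnth_mktuple (tnth_nth x).
  apply/seteqP; split=> s /=.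
    move=> Xs; exists (hist (X s) n); first by rewrite /= tnth_mktuple.
    exact: (esym (hE _)).
  move=> [h /= <-] Xh; have {Xh}<- : hist (X s) n = h by rewrite -[RHS]hE.
  by rewrite tnth_mktuple.
by apply: fin_bigcup_measurable => // h _; exact: m_event.
Qed.

Lemma traj_law_exists :
  exists P : probability (traj_space M) R, is_traj_law pi x P.
Proof.
have [P PE] := image_probability m X_measurable.
exists P; split=> [|n h y]; rewrite !PE.
  have -> : X @^-1` [set w | w 0%N = x] = setT.
    by apply/seteqP; split=> s //= _; exact: X0.
  exact: probability_setT.
pose w i := if (i <= n)%N then nth x h i else y.
have hw : hist w n = h.
  apply: eq_from_tnth => i.
  by rewrite tnth_mktuple /w -ltnS ltn_ord (tnth_nth x).
have wSn : w n.+1 = y by rewrite /w ltnn.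
have -> : X @^-1` [set v | hist v n = h] = event w n by rewrite /event hw.
have -> : X @^-1` ([set v | hist v n = h] `&` [set v | v n.+1 = y]) =
    event w n.+1.
  rewrite -hw -wSn; apply/seteqP; split=> s /=.
    move=> [/histP a b]; apply/histP => i.
    by rewrite leq_eqVlt => /predU1P[->//|]; exact: a.
  by move=> /histP a; split; [apply/histP/(agreeW (leqnSn n) a)|exact: a].
have [w0|w0] := pselect (w 0%N = x); last first.
  by rewrite !event0 // measure0 mul0e.
rewrite !m_eventE // wtS EFinM wSn /q hw; congr (_ * (trans _ _ _ _)%:E)%E.
by rewrite -hw tnth_mktuple.
Qed.

End traj_law_construction.

(* The conditions in [is_traj_law] fix the probability of every event
   {X_0 = x_0, ..., X_n = x_n}, so they determine the law on the sigma-algebra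
   generated by the coordinates. *)
Definition traj_law (R : realType) (E U : finType) (M : mdp R E U)
    (pi : policy E U) (x : E) : probability (traj_space M) R :=
  sval (cid (traj_law_exists M pi x)).

Definition trans_n (R : realType) (E U : finType) (M : mdp R E U)
    (pi : policy E U) (n : nat) (x y : E) : R :=
  fine (traj_law M pi x [set w | w n = y]).

Definition total_reward (R : realType) (E U : finType) (M : mdp R E U)
    (beta : R) (pi : policy E U) (w : traj_space M) : R :=
  limn (fun n => \sum_(0 <= i < n) beta ^+ i * reward M (w i) (pi i (hist w i))).
Arguments total_reward {R E U} M beta pi w.

(* J_gamma(x, pi; beta) *)
Definition criterion (R : realType) (E U : finType) (M : mdp R E U)
    (beta gamma : R) (x : E) (pi : policy E U) : R :=
  if gamma == 0 then
    fine 'E_(traj_law M pi x)[total_reward M beta pi]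
  else
    gamma^-1 *
    ln (fine 'E_(traj_law M pi x)[fun w => expR (gamma * total_reward M beta pi w)]).

(* w^beta(x, gamma).  For 0 < beta < 1 the criterion is bounded uniformly in the
   policy, hence this supremum in R is the genuine one. *)
Definition value (R : realType) (E U : finType) (M : mdp R E U)
    (beta : R) (x : E) (gamma : R) : R :=
  sup [set criterion M beta gamma x pi | pi in [set: policy E U]].

(* Pi^*(beta, gamma) *)
Definition optimal (R : realType) (E U : finType) (M : mdp R E U)
    (beta gamma : R) : set (policy E U) :=
  [set pi | is_markov pi /\
    forall x, criterion M beta gamma x pi = value M beta x gamma].

(* The maximiser of least index in [enum U].  Since [U] is finite and nonempty
   the sequence of maximisers is nonempty, so the default [a0] plays no role. *)
Definition first_argmax (R : realType) (U : finType) (a0 : U) (F : U -> R) : U :=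
  head a0 [seq a <- enum U | [forall b, F b <= F a]].

Definition bellman_policy (R : realType) (E U : finType) (M : mdp R E U)
    (beta gamma : R) (i : nat) (x : E) : U :=
  first_argmax (some_action M) (fun a =>
    if gamma == 0 then
      reward M x a + \sum_y beta * value M beta y 0 * trans M a x y
    else
      reward M x a + (gamma * beta ^+ i)^-1 *
        ln (\sum_y expR (gamma * beta ^+ i.+1 *
                         value M beta y (gamma * beta ^+ i.+1)) * trans M a x y)).

Definition assumption_A1 (R : realType) (E U : finType) (M : mdp R E U) : Prop :=
  (ereal_sup [set r | exists (x x' : E) (A : {set E}) (a a' : U),
     r = `|trans_set M a x A - trans_set M a' x' A|%:E] < 1)%E.

(* p / q with the conventions 0 / 0 = 1 and p / 0 = +oo for p > 0 *)
Definition ratio (R : realType) (p q : R) : \bar R :=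
  if q == 0 then (if p == 0 then 1%E else +oo%E) else (p / q)%:E.

Definition assumption_A2 (R : realType) (E U : finType) (M : mdp R E U) : Prop :=
  exists N : nat,
  (ereal_sup [set r | exists (x x' y : E) (pi : policy E U),
     is_markov pi /\ r = ratio (trans_n M pi N x y) (trans_n M pi N x' y)]
   < +oo)%E.

(* Main.v *)
Require Import Defs.
From mathcomp Require Import all_boot all_order all_algebra.
From mathcomp Require Import all_classical all_reals all_analysis.
From mathcomp Require Import measurable_realfun ring lra.
Import Order.TTheory GRing.Theory Num.Theory.
Import numFieldNormedType.Exports.
Set Implicit Arguments.
Unset Strict Implicit.
Unset Printing Implicit Defensive.
Local Open Scope classical_set_scope.
Local Open Scope ring_scope.

(** The theorem is a perturbation argument around gamma = 0.

    Risk-neutral side.  The Bellman operator has a fixed point v, the limit of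
    value iteration ([bellman_solution_exists]).  Paying v at time n in place
    of the rewards still to come gives a payoff whose mean is nonincreasing in
    n under every policy, because v dominates its Bellman objective, and is
    constant in n under a stationary policy greedy for v
    ([mean_stopped_rewardS]).  Its mean is v(x) for n = 0 and tends to the
    risk-neutral criterion.  Hence v is the risk-neutral value and every
    stationary policy greedy for v is optimal ([greedy_optimal]).  It remains
    to show that the first constituent of the Bellman-induced policy is greedy
    for v.

    Small risk aversion.  For a random variable X bounded by B, the certainty
    equivalent c^-1 ln E[exp (c X)] differs from E[X] by at most 2 |c| B^2 as
    soon as |c| B <= 1/2: Jensen's inequality on one side, a quadratic bound on
    the exponential on the other ([certainty_equivalent_approx]).  The bound
    does not see the law of X.  Used for the total reward, uniformly in the
    policy, it makes the risk-sensitive value converge to v ([value_dist]);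
    used once more for one transition, it makes the risk-sensitive objective
    maximised by the Bellman-induced policy converge to the risk-neutral one
    ([risk_objective_dist]).

    Finiteness.  There are finitely many pairs of actions in finitely many
    states, so the positive gaps between risk-neutral objectives are bounded
    below by some g > 0.  Once the two objectives are closer than g / 2, a
    maximiser of the risk-sensitive one also maximises the risk-neutral one
    ([bellman_policy_greedy]). *)

(** * Certainty equivalents at small risk aversion *)
Section entropic.
Variable R : realType.
Implicit Types (d B m s t z : R).

Lemma expR_ge_tangent s t : expR s * (1 + (t - s)) <= expR t.
Proof.
have := expR_ge1Dx (t - s).
by move=> /(ler_wpM2l (expR_ge0 s)); rewrite -expRD subrKC.
Qed.

(** The inequality exp (- t) >= 1 - t, inverted, bounds exp t by 1 / (1 - t),
    which no longer involves the exponential. *)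
Lemma expR_le_quadratic t : `|t| <= 1 / 2 -> expR t <= 1 + t + 2 * t ^+ 2.
Proof.
rewrite ler_norml => /andP[t1 t2].
have t0 : 0 < 1 - t by lra.
have h := expR_ge1Dx (- t).
rewrite -[t in expR t]opprK expRN.
apply: (@le_trans _ _ (1 - t)^-1).
  by rewrite lef_pV2 // posrE ?expR_gt0.
rewrite -[X in X <= _]mul1r ler_pdivrMr //.
have : 0 <= t ^+ 2 * (1 - 2 * t) by rewrite mulr_ge0 ?sqr_ge0 //; lra.
by nra.
Qed.

Lemma expR_le_affine d B t : `|d| * B <= 1 / 2 -> `|t| <= B ->
  expR (d * t) <= 1 + d * t + 2 * (d * B) ^+ 2.
Proof.
move=> dB tB; have B0 : 0 <= B by exact: le_trans tB.
have h : `|d * t| <= `|d| * B by rewrite normrM ler_wpM2l.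
apply: (le_trans (expR_le_quadratic (le_trans h dB))).
rewrite lerD2l ler_wpM2l // -[(d * t) ^+ 2]real_normK ?num_real //.
rewrite -[(d * B) ^+ 2]real_normK ?num_real // !normrM (ger0_norm B0).
by rewrite lerXn2r ?nnegrE ?mulr_ge0 // ler_wpM2l.
Qed.

(** Here z stands for E[exp (d X)] and m for E[X], with |X| <= B.  The two
    hypotheses are the means of the tangent bound at d m (Jensen) and of the
    quadratic bound.  Keeping z abstract serves both finite sums and
    integrals. *)
Lemma certainty_equivalent_approx d B m z : d != 0 ->
  expR (d * m) <= z -> z <= 1 + d * m + 2 * (d * B) ^+ 2 ->
  `|d^-1 * ln z - m| <= 2 * `|d| * B ^+ 2.
Proof.
move=> d0 zl zu.
have z0 : 0 < z by apply: lt_le_trans zl; exact: expR_gt0.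
have l1 : d * m <= ln z by rewrite -ler_expR lnK.
have l2 : ln z <= d * m + 2 * (d * B) ^+ 2.
  have := @le_ln1Dx _ (z - 1); rewrite subrKC => h.
  by have := h ltac:(lra); lra.
have -> : d^-1 * ln z - m = d^-1 * (ln z - d * m).
  by rewrite mulrBr mulKf.
rewrite normrM normfV ger0_norm ?subr_ge0 //.
rewrite ler_pdivrMl ?normr_gt0 //.
have -> : `|d| * (2 * `|d| * B ^+ 2) = 2 * (d * B) ^+ 2.
  by rewrite exprMn -(real_normK (num_real d)); ring.
by lra.
Qed.

Lemma certainty_equivalent_sum (I : finType) (p f : I -> R) d B :
  (forall i, 0 <= p i) -> \sum_i p i = 1 -> (forall i, `|f i| <= B) ->
  d != 0 -> `|d| * B <= 1 / 2 ->
  `|d^-1 * ln (\sum_i expR (d * f i) * p i) - \sum_i f i * p i|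
    <= 2 * `|d| * B ^+ 2.
Proof.
move=> p0 p1 fB d0 dB; set m := \sum_i f i * p i.
have aff a b : \sum_i (a + b * f i) * p i = a + b * m.
  rewrite -[a in RHS]mulr1 -p1 !mulr_sumr -big_split /=.
  by apply: eq_bigr => i _; ring.
apply: certainty_equivalent_approx => //.
  apply: (@le_trans _ _ (\sum_i (expR (d * m) * (1 - d * m) +
    (expR (d * m) * d) * f i) * p i)).
    by rewrite aff le_eqVlt; apply/orP; left; apply/eqP; ring.
  apply: ler_sum => i _; rewrite ler_wpM2r //.
  by apply: le_trans (expR_ge_tangent (d * m) _); lra.
have -> : 1 + d * m + 2 * (d * B) ^+ 2 = 1 + 2 * (d * B) ^+ 2 + d * m by ring.
rewrite -aff; apply: ler_sum => i _; rewrite ler_wpM2r //.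
by apply: le_trans (expR_le_affine dB (fB i)) _; lra.
Qed.
End entropic.

(** * Means of bounded random variables *)
Section bounded.
Context {d : measure_display} {T : measurableType d} {R : realType}.
Variable P : probability T R.
Implicit Types f g : T -> R.

Definition bounded_measurable f :=
  measurable_fun setT f /\ exists B, forall t, `|f t| <= B.

Lemma bounded_measurable_cst (a : R) : bounded_measurable (fun=> a).
Proof. by split; [exact: measurable_cst|exists `|a|]. Qed.

Lemma bounded_measurableD f g : bounded_measurable f -> bounded_measurable g ->
  bounded_measurable (fun t => f t + g t).
Proof.
move=> [mf [A fA]] [mg [B gB]]; split; first exact: measurable_funD.
by exists (A + B) => t; rewrite (le_trans (ler_normD _ _)) // lerD.
Qed.

Lemma bounded_measurableZ (a : R) f : bounded_measurable f ->
  bounded_measurable (fun t => a * f t).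
Proof.
move=> [mf [A fA]]; split.
  by apply: measurable_funM => //; exact: measurable_cst.
by exists (`|a| * A) => t; rewrite normrM ler_wpM2l.
Qed.

Lemma bounded_measurable_expR f : bounded_measurable f ->
  bounded_measurable (expR \o f).
Proof.
move=> [mf [A fA]]; split; first exact: measurableT_comp.
exists (expR A) => t; rewrite ger0_norm ?expR_ge0 //= ler_expR.
exact: le_trans (ler_norm _) (fA t).
Qed.

Definition mean f := fine 'E_P[f].

Lemma meanE f : mean f = \int[P]_t f t.
Proof. by rewrite /mean unlock. Qed.

Lemma bounded_measurable_integrable f : bounded_measurable f ->
  P.-integrable setT (EFin \o f).
Proof.
move=> [mf [B fB]]; apply: measurable_bounded_integrable => //.
  exact: le_lt_trans (probability_le1 P measurableT) (ltry 1).
by exists B; split=> [|x Bx t _]; [exact: num_real|exact: le_trans (ltW Bx)].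
Qed.

Lemma meanD f g : bounded_measurable f -> bounded_measurable g ->
  mean (fun t => f t + g t) = mean f + mean g.
Proof.
by move=> bf bg; rewrite !meanE RintegralD //; exact: bounded_measurable_integrable.
Qed.

Lemma meanZ (a : R) f : bounded_measurable f ->
  mean (fun t => a * f t) = a * mean f.
Proof.
by move=> bf; rewrite !meanE RintegralZl //; exact: bounded_measurable_integrable.
Qed.

Lemma mean_cst (a : R) : mean (fun=> a) = a.
Proof. by rewrite /mean expectation_cst. Qed.

Lemma le_mean f g : bounded_measurable f -> bounded_measurable g ->
  (forall t, f t <= g t) -> mean f <= mean g.
Proof.
by move=> bf bg fg; rewrite !meanE; apply: le_Rintegral => //;
  exact: bounded_measurable_integrable.
Qed.

Lemma certainty_equivalent_mean f (c B : R) :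
  measurable_fun setT f -> (forall t, `|f t| <= B) ->
  c != 0 -> `|c| * B <= 1 / 2 ->
  `|c^-1 * ln (mean (fun t => expR (c * f t))) - mean f| <= 2 * `|c| * B ^+ 2.
Proof.
move=> mf fB c0 cB; have bf : bounded_measurable f by split=> //; exists B.
have be := bounded_measurable_expR (bounded_measurableZ c bf).
have baff a b : bounded_measurable (fun t => a + b * f t).
  by apply: bounded_measurableD (bounded_measurable_cst a) (bounded_measurableZ b bf).
have aff a b : mean (fun t => a + b * f t) = a + b * mean f.
  rewrite meanD ?mean_cst ?meanZ //; first exact: bounded_measurable_cst.
  exact: bounded_measurableZ.
apply: certainty_equivalent_approx => //; set m := mean f.
  have -> : expR (c * m) = mean (fun t => expR (c * m) * (1 - c * m) +
      (expR (c * m) * c) * f t) by rewrite aff -/m; ring.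
  apply: le_mean => // t.
  by apply: le_trans (expR_ge_tangent (c * m) _); lra.
have -> : 1 + c * m + 2 * (c * B) ^+ 2 = 1 + 2 * (c * B) ^+ 2 + c * m by ring.
rewrite -aff; apply: le_mean => // t.
by apply: le_trans (expR_le_affine cB (fB t)) _; lra.
Qed.

(** A function of a finite-valued variable is a combination of indicators, hence
    measurable, bounded, and with an explicit mean. *)
Lemma finite_valued_sum (I : finType) (F : T -> I) (g : I -> R) t :
  g (F t) = \sum_i g i * \1_[set u | F u = i] t.
Proof.
rewrite (bigD1 (F t)) //= indicE mem_set //= mulr1 big1 ?addr0 // => i neq.
by rewrite indicE memNset ?mulr0 //= => /esym/eqP; rewrite (negbTE neq).
Qed.

Section finite_valued.
Variables (I : finType) (F : T -> I).
Hypothesis mF : forall i, measurable [set t | F t = i].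

Lemma bounded_measurable_finite (g : I -> R) :
  bounded_measurable (fun t => g (F t)).
Proof.
split.
  rewrite (_ : (fun t => _) = fun t => \sum_i g i * \1_[set u | F u = i] t).
    apply: measurable_sum => i; apply: measurable_funM.
      exact: measurable_cst.
    exact: measurable_indic.
  by apply/funext => t; exact: finite_valued_sum.
exists (\sum_i `|g i|) => t.
by rewrite (bigD1 (F t)) //= lerDl sumr_ge0.
Qed.

Lemma mean_finite (g : I -> R) :
  mean (fun t => g (F t)) = \sum_i g i * fine (P [set t | F t = i]).
Proof.
rewrite (_ : (fun t => _) = fun t => \sum_i g i * \1_[set u | F u = i] t);
  last by apply/funext => t; exact: finite_valued_sum.
pose H (r : seq I) t := \sum_(i <- r) g i * \1_[set u | F u = i] t.
have b i : bounded_measurable (\1_[set u | F u = i] : T -> R).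
  split; first exact: measurable_indic.
  by exists 1 => t; rewrite indicE ger0_norm // lern1; case: (_ \in _).
have bH r : bounded_measurable (H r).
  elim: r => [|i r IH].
    rewrite (_ : H _ = fun=> 0); first exact: bounded_measurable_cst.
    by apply/funext => t; rewrite /H big_nil.
  rewrite (_ : H _ = fun t => g i * \1_[set u | F u = i] t + H r t).
    by apply: bounded_measurableD => //; exact: bounded_measurableZ.
  by apply/funext => t; rewrite /H big_cons.
have: forall r, mean (H r) = \sum_(i <- r) g i * fine (P [set t | F t = i]).
  elim=> [|i r IH].
    rewrite (_ : H _ = fun=> 0); first by rewrite mean_cst big_nil.
    by apply/funext => t; rewrite /H big_nil.
  rewrite (_ : H _ = fun t => g i * \1_[set u | F u = i] t + H r t).
    rewrite meanD // ?meanZ //; last exact: bounded_measurableZ.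
    by rewrite big_cons IH [mean _]/mean expectation_indic.
  by apply/funext => t; rewrite /H big_cons.
by move=> /(_ (index_enum I)).
Qed.
End finite_valued.
End bounded.

(** * Finite optimisation *)
Lemma first_argmax_ge (R : realType) (U : finType) (a0 : U) (F : U -> R) b :
  F b <= F (first_argmax a0 F).
Proof.
have [a ha] : exists a, forall b, F b <= F a.
  case: (arg_maxP (P := xpredT) F (i0 := a0)) => // a _ h; exists a => c.
  exact: h.
have: a \in [seq a <- enum U | [forall b, F b <= F a]].
  by rewrite mem_filter mem_enum andbT; apply/forallP.
rewrite /first_argmax; case E: [seq _ <- _ | _] => [//|c s] _ /=.
have: c \in [seq a <- enum U | [forall b, F b <= F a]].
  by rewrite E mem_head.
by rewrite mem_filter => /andP[/forallP].
Qed.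

Lemma fin_positive_lower_bound (R : realType) (I : finType) (f : I -> R) :
  exists2 g, 0 < g & forall i, 0 < f i -> g <= f i.
Proof.
exists (\big[Num.min/1]_(i | 0 < f i) f i); first exact/lt_bigmin.
by move=> i fi; exact: bigmin_le_cond.
Qed.

(** * The risk-neutral Bellman equation *)
Section dynamic_programming.
Variables (R : realType) (E U : finType) (M : mdp R E U) (beta : R).
Hypothesis beta01 : 0 < beta < 1.
Implicit Types (v : E -> R) (u : E -> U).

Definition bellman_objective v x a : R :=
  reward M x a + \sum_y beta * v y * trans M a x y.

Definition greedy v u :=
  forall x b, bellman_objective v x b <= bellman_objective v x (u x).

Definition bellman_solution v := exists u,
  greedy v u /\ forall x, v x = bellman_objective v x (u x).

Let b0 : 0 <= beta. Proof. by case/andP: beta01 => /ltW. Qed.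

Lemma le_bellman_objective v v' x a : (forall y, v y <= v' y) ->
  bellman_objective v x a <= bellman_objective v' x a.
Proof.
move=> vv'; rewrite lerD2l; apply: ler_sum => y _.
by rewrite ler_wpM2r ?trans_ge0 // ler_wpM2l.
Qed.

Variable D : R.
Hypothesis rewardD : forall x a, `|reward M x a| <= (1 - beta) * D.

Lemma bellman_objective_cst c x a :
  bellman_objective (fun=> c) x a = reward M x a + beta * c.
Proof. by rewrite /bellman_objective -mulr_sumr trans_sum1 mulr1. Qed.

Let T v x := bellman_objective v x
  (first_argmax (some_action M) (bellman_objective v x)).

Let T_ge v x a : bellman_objective v x a <= T v x.
Proof. exact: first_argmax_ge. Qed.

Let T_mono v v' : (forall y, v y <= v' y) -> forall x, T v x <= T v' x.
Proof. by move=> vv' x; apply: le_trans (T_ge _ _ _); exact: le_bellman_objective. Qed.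

Let vi n : E -> R := iter n T (fun=> - D).

Let vi_leS n x : vi n x <= vi n.+1 x.
Proof.
elim: n x => [|n IH] x; last exact: T_mono.
apply: le_trans (T_ge _ _ (some_action M)).
rewrite bellman_objective_cst.
by have := rewardD x (some_action M); rewrite ler_norml => /andP[? ?]; rewrite /vi /=; lra.
Qed.

Let vi_leD n x : vi n x <= D.
Proof.
elim: n x => [|n IH] x.
  have := le_trans (normr_ge0 _) (rewardD x (some_action M)).
  rewrite pmulr_rge0 /=; last by case/andP: beta01 => ? ?; lra.
  by lra.
apply: le_trans (le_bellman_objective _ _ IH) _; rewrite bellman_objective_cst.
by have := rewardD x (first_argmax (some_action M) (bellman_objective (vi n) x));
  rewrite ler_norml => /andP[? ?]; rewrite /vi /=; lra.
Qed.

Let vi_nd x : nondecreasing_seq (vi ^~ x).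
Proof. by apply/nondecreasing_seqP => n; exact: vi_leS. Qed.

Let vi_cvg x : cvgn (vi ^~ x).
Proof.
apply: nondecreasing_is_cvgn => //; exists D => _ [n _ <-]; exact: vi_leD.
Qed.

(** Value iteration from the constant - D is nondecreasing, because D is chosen
    with |reward| <= (1 - beta) D, and is bounded by D; its pointwise limit
    solves the Bellman equation. *)
Lemma bellman_solution_exists :
  exists v, bellman_solution v /\ forall x, `|v x| <= D.
Proof.
pose v x := limn (vi ^~ x).
have viv n x : vi n x <= v x by exact: nondecreasing_cvgn_le.
have le_v x a : bellman_objective v x a <= v x.
  have h : (fun n => bellman_objective (vi n) x a) @ \oo -->
      bellman_objective v x a.
    apply: cvgD; first exact: cvg_cst.
    apply: cvg_big => [|y _]; first exact: add_continuous.
    by apply: cvgM (cvg_cst _); apply: cvgM (cvg_cst _) _; exact: vi_cvg.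
  apply: (cvgr_to_le h); near=> n.
  exact: le_trans (T_ge _ _ _) (viv n.+1 x).
have ge_v x : v x <= T v x.
  apply: limr_le; first exact: vi_cvg.
  near=> n; apply: le_trans (vi_leS n x) _.
  by apply: T_mono.
exists v; split; last first.
  move=> x; rewrite ler_norml (viv 0%N x) /=.
  by apply: limr_le; [exact: vi_cvg|near=> n].
exists (fun x => first_argmax (some_action M) (bellman_objective v x)); split.
  by move=> x b; exact: T_ge.
by move=> x; apply/eqP; rewrite eq_le ge_v le_v.
Unshelve. all: by end_near. Qed.

End dynamic_programming.

(** * The law of the trajectory *)
Section law.
Variables (R : realType) (E U : finType) (M : mdp R E U).
Variables (pi : policy E U) (x : E).
Local Notation mean := (mean (traj_law M pi x)).

Lemma measurable_hist n (h : n.+1.-tuple E) :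
  measurable [set w : traj_space M | hist w n = h].
Proof.
rewrite (_ : [set _ | _] =
    \bigcap_(i in [set: 'I_n.+1]) [set w : traj_space M | w i = tnth h i]).
  apply: fin_bigcap_measurable => // i _.
  by apply: sub_sigma_algebra; exists (val i), (tnth h i).
apply/seteqP; split=> w /=.
  by move=> <- i _ /=; rewrite tnth_mktuple.
by move=> hw; apply: eq_from_tnth => i; rewrite tnth_mktuple; exact: hw.
Qed.

Lemma measurable_coord n (y : E) : measurable [set w : traj_space M | w n = y].
Proof. by apply: sub_sigma_algebra; exists n, y. Qed.

Let transition n (w : traj_space M) := (hist w n, w n.+1).

Let transitionE n h y : [set w | transition n w = (h, y)] =
  [set w | hist w n = h] `&` [set w | w n.+1 = y].
Proof. by apply/seteqP; split=> w; rewrite /= /transition => -[-> ->]. Qed.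

Let measurable_transition n p : measurable [set w | transition n w = p].
Proof.
case: p => h y; rewrite transitionE.
by apply: measurableI; [exact: measurable_hist|exact: measurable_coord].
Qed.

Lemma bounded_measurable_hist n (g : n.+1.-tuple E -> R) :
  bounded_measurable (fun w : traj_space M => g (hist w n)).
Proof. by apply: bounded_measurable_finite; exact: measurable_hist. Qed.

Lemma bounded_measurable_transition n (g : n.+1.-tuple E -> E -> R) :
  bounded_measurable (fun w : traj_space M => g (hist w n) (w n.+1)).
Proof.
exact: (bounded_measurable_finite (measurable_transition (n := n))
  (fun p => g p.1 p.2)).
Qed.

Lemma traj_lawP : is_traj_law pi x (traj_law M pi x).
Proof. exact: svalP (cid (traj_law_exists M pi x)). Qed.

(** The controlled Markov property, in the form used by dynamic programming:
    the next state may be averaged out given the history. *)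
Lemma mean_transition n (g : n.+1.-tuple E -> E -> R) :
  mean (fun w => g (hist w n) (w n.+1)) =
  mean (fun w => \sum_y g (hist w n) y * trans M (pi (hist w n)) (w n) y).
Proof.
rewrite (mean_finite _ (measurable_transition (n := n)) (fun p => g p.1 p.2)).
pose G (h : n.+1.-tuple E) :=
  \sum_y g h y * trans M (pi h) (tnth h ord_max) y.
rewrite (_ : (fun w => \sum_y _) = fun w => G (hist w n)); last first.
  by apply/funext => w; apply: eq_bigr => y _; rewrite tnth_mktuple.
rewrite (mean_finite _ (@measurable_hist n)) /=.
rewrite (eq_bigr (fun p => g p.1 p.2 * fine (traj_law M pi x
  [set w | transition n w = (p.1, p.2)]))); last by case.
rewrite -(pair_bigA _ (fun h y => g h y * fine (traj_law M pi x
  [set w | transition n w = (h, y)]))) /=.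
apply: eq_bigr => h _; rewrite mulr_suml; apply: eq_bigr => y _.
rewrite transitionE (proj2 traj_lawP) fineM //; last first.
  by apply: fin_num_measure; exact: measurable_hist.
by rewrite -mulrA; congr (_ * _); rewrite mulrC.
Qed.

Lemma mean_start (v : E -> R) : mean (fun w => v (w 0%N)) = v x.
Proof.
rewrite (mean_finite _ (measurable_coord 0)) (bigD1 x) //=.
rewrite (proj1 traj_lawP) /= mulr1 big1 ?addr0 // => y yx.
suff -> : traj_law M pi x [set w | w 0%N = y] = 0%E by rewrite mulr0.
apply/eqP; rewrite eq_le measure_ge0 andbT.
have <- : traj_law M pi x (~` [set w | w 0%N = x]) = 0%E.
  rewrite probability_setC; last exact: measurable_coord.
  by rewrite (proj1 traj_lawP) subee.
apply: le_measure; rewrite ?inE.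
- exact: measurable_coord.
- by apply: measurableC; exact: measurable_coord.
by move=> w /= -> /eqP; rewrite (negbTE yx).
Qed.
End law.

(** * Dynamic programming for the discounted reward *)
Section discounted_reward.
Variables (R : realType) (E U : finType) (M : mdp R E U) (beta D : R).
Hypothesis beta01 : 0 < beta < 1.
Hypothesis rewardD : forall x a, `|reward M x a| <= (1 - beta) * D.
Implicit Types (pi : policy E U) (v : E -> R) (u : E -> U) (w : traj_space M).

Let b0 : 0 <= beta. Proof. by case/andP: beta01 => /ltW. Qed.

Definition partial_reward pi n w :=
  \sum_(0 <= i < n) beta ^+ i * reward M (w i) (pi i (hist w i)).

Let stageD pi i w : `|beta ^+ i * reward M (w i) (pi i (hist w i))| <=
  ((1 - beta) * D) * beta ^+ i.
Proof.
by rewrite normrM (ger0_norm (exprn_ge0 _ b0)) mulrC ler_wpM2r ?exprn_ge0.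
Qed.

(** Geometric tail estimate, uniform in the policy and the trajectory. *)
Lemma partial_reward_dist pi m n w : (m <= n)%N ->
  `|partial_reward pi n w - partial_reward pi m w| <=
    (beta ^+ m - beta ^+ n) * D.
Proof.
move=> /subnK <-; elim: (n - m)%N => [|k IH]; first by rewrite !subrr mul0r normr0.
rewrite addSn /partial_reward big_nat_recr //= addrAC.
apply: le_trans (ler_normD _ _) _.
apply: le_trans (lerD IH (stageD pi _ w)) _.
by rewrite exprS; lra.
Qed.

Lemma partial_reward_cvg pi w :
  partial_reward pi ^~ w @ \oo --> total_reward M beta pi w.
Proof.
suff : cvgn (partial_reward pi ^~ w) by [].
apply: normed_cvg; apply: series_le_cvg (@is_cvg_geometric_series _ ((1 - beta) * D) beta _).
- by move=> n; exact: normr_ge0.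
- move=> n; rewrite /= mulr_ge0 ?exprn_ge0 //.
  exact: le_trans (normr_ge0 _) (rewardD (some_state M) (some_action M)).
- by move=> n; exact: stageD.
by rewrite ger0_norm //; case/andP: beta01.
Qed.

Lemma total_reward_dist pi n w :
  `|total_reward M beta pi w - partial_reward pi n w| <= beta ^+ n * D.
Proof.
have D0 : 0 <= D.
  have := le_trans (normr_ge0 _) (rewardD (some_state M) (some_action M)).
  by rewrite pmulr_rge0 //; case/andP: beta01 => ? ?; lra.
have cvgS := @partial_reward_cvg pi w.
have near_le : \forall m \near \oo,
    `|partial_reward pi m w - partial_reward pi n w| <= beta ^+ n * D.
  exists n => // m /= nm; apply: le_trans (partial_reward_dist pi w nm) _.
  by rewrite ler_wpM2r // gerBl exprn_ge0.
have c : (fun m => `|partial_reward pi m w - partial_reward pi n w|) @ \oo -->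
    `|total_reward M beta pi w - partial_reward pi n w|.
  by apply: cvg_norm; apply: cvgB cvgS _; exact: cvg_cst.
exact: cvgr_to_le c near_le.
Qed.

Lemma total_reward_le pi w : `|total_reward M beta pi w| <= D.
Proof.
have := total_reward_dist pi 0 w.
by rewrite /partial_reward big_geq // subr0 expr0 mul1r.
Qed.

Lemma bounded_measurable_partial_reward pi n :
  bounded_measurable (partial_reward pi n).
Proof.
elim: n => [|n IH].
  rewrite (_ : partial_reward _ _ = fun=> 0); first exact: bounded_measurable_cst.
  by apply/funext => w; rewrite /partial_reward big_geq.
pose g (h : n.+1.-tuple E) := beta ^+ n * reward M (tnth h ord_max) (pi n h).
rewrite (_ : partial_reward _ _ = fun w => partial_reward pi n w + g (hist w n)).
  by apply: bounded_measurableD => //; exact: bounded_measurable_hist.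
by apply/funext => w; rewrite /partial_reward big_nat_recr //= /g tnth_mktuple.
Qed.

Lemma measurable_total_reward pi : measurable_fun setT (total_reward M beta pi).
Proof.
apply: (measurable_fun_cvg (h := partial_reward pi)) => [n|w _].
  exact: (proj1 (bounded_measurable_partial_reward pi n)).
exact: partial_reward_cvg.
Qed.

Lemma bounded_measurable_total_reward pi :
  bounded_measurable (total_reward M beta pi).
Proof.
by split; [exact: measurable_total_reward|exists D; exact: total_reward_le].
Qed.

(** Interpolates between v at the initial state (n = 0) and the total reward. *)
Definition stopped_reward v pi n w := partial_reward pi n w + beta ^+ n * v (w n).

Lemma bounded_measurable_stopped_reward v pi n :
  bounded_measurable (stopped_reward v pi n).
Proof.
apply: bounded_measurableD; first exact: bounded_measurable_partial_reward.
by apply: bounded_measurableZ; apply: bounded_measurable_finite => y;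
  exact: measurable_coord.
Qed.

(** One step of dynamic programming: the mean drifts by the discounted defect of
    v in the Bellman equation, at the action that the policy takes. *)
Lemma mean_stopped_rewardS v pi x n :
  mean (traj_law M pi x) (stopped_reward v pi n.+1) =
  mean (traj_law M pi x) (stopped_reward v pi n) +
  beta ^+ n * mean (traj_law M pi x)
    (fun w => bellman_objective M beta v (w n) (pi n (hist w n)) - v (w n)).
Proof.
pose g (h : n.+1.-tuple E) y :=
  reward M (tnth h ord_max) (pi n h) + beta * v y - v (tnth h ord_max).
have bg := @bounded_measurable_transition _ _ _ M n g.
rewrite (_ : stopped_reward v pi n.+1 = fun w => stopped_reward v pi n w +
    beta ^+ n * g (hist w n) (w n.+1)); last first.
  apply/funext => w; rewrite /stopped_reward /partial_reward big_nat_recr //=.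
  by rewrite /g tnth_mktuple /= exprSr; ring.
rewrite meanD; [|exact: bounded_measurable_stopped_reward
  |exact: bounded_measurableZ].
rewrite meanZ // mean_transition; congr (_ + _ * mean _ _).
apply/funext => w; rewrite /bellman_objective /g tnth_mktuple /=.
set r := reward _ _ _; set p := trans _ _ _.
rewrite (eq_bigr (fun y => (r - v (w n)) * p y + beta * v y * p y)); last first.
  by move=> y _; ring.
by rewrite big_split /= -mulr_sumr trans_sum1 mulr1 addrAC.
Qed.

Lemma mean_stopped_reward0 v pi x :
  mean (traj_law M pi x) (stopped_reward v pi 0) = v x.
Proof.
rewrite -(mean_start M pi x v); congr (mean _ _); apply/funext => w.
by rewrite /stopped_reward /partial_reward big_geq // add0r expr0 mul1r.
Qed.

Lemma criterion0E pi x :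
  criterion M beta 0 x pi = mean (traj_law M pi x) (total_reward M beta pi).
Proof. by rewrite /criterion eqxx. Qed.

Lemma criterion0_dist_stopped v pi x n : (forall y, `|v y| <= D) ->
  `|criterion M beta 0 x pi - mean (traj_law M pi x) (stopped_reward v pi n)|
    <= 2 * D * beta ^+ n.
Proof.
move=> vD; rewrite criterion0E.
set t := total_reward M beta pi; set s := stopped_reward v pi n.
have bs : bounded_measurable s by exact: bounded_measurable_stopped_reward.
have bt : bounded_measurable t by exact: bounded_measurable_total_reward.
have ts w : `|t w - s w| <= 2 * D * beta ^+ n.
  have h1 := total_reward_dist pi n w.
  have h2 : `|beta ^+ n * v (w n)| <= beta ^+ n * D.
    by rewrite normrM (ger0_norm (exprn_ge0 _ b0)) ler_wpM2l ?exprn_ge0.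
  have -> : t w - s w = (t w - partial_reward pi n w) - beta ^+ n * v (w n).
    by rewrite /s /stopped_reward; ring.
  by apply: le_trans (ler_normB _ _) _; rewrite /t; lra.
have bc (c : R) f : bounded_measurable f ->
    bounded_measurable (fun w : traj_space M => c + f w).
  by move=> bf; apply: bounded_measurableD => //; exact: bounded_measurable_cst.
have mc (c : R) f : bounded_measurable f ->
    mean (traj_law M pi x) (fun w => c + f w) = c + mean (traj_law M pi x) f.
  by move=> bf; rewrite meanD ?mean_cst //; exact: bounded_measurable_cst.
rewrite ler_distl lerBlDl -!mc // [X in _ && (_ <= X)]addrC -!mc //.
by apply/andP; split; apply: le_mean => //; try exact: bc;
  move=> w; have := ts w; rewrite ler_norml => /andP[? ?]; lra.
Qed.

Let le_geometric a b : (forall n, a <= b + 2 * D * beta ^+ n) -> a <= b.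
Proof.
move=> h.
have c : (fun n => b + 2 * D * beta ^+ n) @ \oo --> b.
  rewrite -[X in _ --> X]addr0; apply: cvgD; first exact: cvg_cst.
  by apply: cvg_geometric; rewrite ger0_norm //; case/andP: beta01.
exact: cvgr_to_ge c (nearW _ h).
Qed.

Variable v : E -> R.
Hypothesis v_sol : bellman_solution M beta v.
Hypothesis vD : forall x, `|v x| <= D.

(** The drift is nonpositive at every action, so no policy, even depending on the
    whole history, gains more than v. *)
Lemma criterion0_le_solution pi x : criterion M beta 0 x pi <= v x.
Proof.
have [u [greedy_u uE]] := v_sol.
have ms n : mean (traj_law M pi x) (stopped_reward v pi n) <= v x.
  elim: n => [|n IH]; first by rewrite mean_stopped_reward0.
  rewrite mean_stopped_rewardS; apply: le_trans IH.
  rewrite gerDl mulr_ge0_le0 ?exprn_ge0 //.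
  pose g (h : n.+1.-tuple E) :=
    bellman_objective M beta v (tnth h ord_max) (pi n h) - v (tnth h ord_max).
  rewrite (_ : (fun w => _) = fun w => g (hist w n)); last first.
    by apply/funext => w; rewrite /g tnth_mktuple.
  rewrite -[leRHS](mean_cst (traj_law M pi x) 0); apply: le_mean.
  - exact: bounded_measurable_hist.
  - exact: bounded_measurable_cst.
  by move=> w; rewrite subr_le0 [leRHS]uE greedy_u.
apply: le_geometric => n.
have := criterion0_dist_stopped pi x n vD; rewrite ler_norml => /andP[? ?].
by have := ms n; lra.
Qed.

(** A greedy policy attains equality in the Bellman equation, so the drift
    vanishes.  It may differ from the one that witnesses [v_sol]. *)
Lemma criterion0_greedy u x : greedy M beta v u ->
  criterion M beta 0 x (stationary u) = v x.
Proof.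
move=> greedy_u; apply/eqP; rewrite eq_le criterion0_le_solution /=.
have uE y : bellman_objective M beta v y (u y) = v y.
  have [u' [greedy_u' u'E]] := v_sol.
  by apply/eqP; rewrite u'E eq_le greedy_u greedy_u'.
have ms n : mean (traj_law M (stationary u) x)
    (stopped_reward v (stationary u) n) = v x.
  elim: n => [|n IH]; first by rewrite mean_stopped_reward0.
  rewrite mean_stopped_rewardS IH (_ : (fun w => _) = fun=> 0).
    by rewrite mean_cst mulr0 addr0.
  by apply/funext => w; rewrite /stationary /Defs.markov tnth_mktuple uE subrr.
apply: le_geometric => n.
have := criterion0_dist_stopped (stationary u) x n vD.
by rewrite ms ler_norml => /andP[? ?]; lra.
Qed.

Lemma value0_solution x : value M beta x 0 = v x.
Proof.
have [u [greedy_u _]] := v_sol.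
apply/eqP; rewrite eq_le; apply/andP; split.
  apply: ge_sup; first by exists (v x), (stationary u) => //; exact: criterion0_greedy.
  by move=> _ [pi _ <-]; exact: criterion0_le_solution.
rewrite -(criterion0_greedy x greedy_u); apply: ub_le_sup.
  by exists (v x) => _ [pi _ <-]; exact: criterion0_le_solution.
by exists (stationary u).
Qed.

Lemma greedy_optimal u : greedy M beta v u -> optimal M beta 0 (stationary u).
Proof.
move=> greedy_u; split=> [|x]; first by exists (fun=> u).
by rewrite value0_solution criterion0_greedy.
Qed.

(** * Convergence of the risk-sensitive value and objective *)
Lemma criterion_dist gamma pi x : gamma != 0 -> `|gamma| * D <= 1 / 2 ->
  `|criterion M beta gamma x pi - criterion M beta 0 x pi|
    <= 2 * `|gamma| * D ^+ 2.
Proof.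
move=> g0 gD; rewrite criterion0E /criterion (negbTE g0).
apply: certainty_equivalent_mean => //; first exact: measurable_total_reward.
exact: total_reward_le.
Qed.

(** A bound uniform in the policy passes to the supremum. *)
Lemma value_dist gamma x : gamma != 0 -> `|gamma| * D <= 1 / 2 ->
  `|value M beta x gamma - v x| <= 2 * `|gamma| * D ^+ 2.
Proof.
move=> g0 gD; set e := 2 * _ * _.
have [u [greedy_u _]] := v_sol.
have ub pi : criterion M beta gamma x pi <= v x + e.
  have := criterion_dist pi x g0 gD; rewrite ler_norml => /andP[_].
  by have := criterion0_le_solution pi x; rewrite -/e; lra.
rewrite ler_distl; apply/andP; split.
  apply: (@le_trans _ _ (criterion M beta gamma x (stationary u))).
    have := criterion_dist (stationary u) x g0 gD; rewrite ler_norml => /andP[+ _].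
    by rewrite (criterion0_greedy x greedy_u) -/e; lra.
  apply: ub_le_sup; last by exists (stationary u).
  by exists (v x + e) => _ [pi _ <-]; exact: ub.
apply: ge_sup; last by move=> _ [pi _ <-]; exact: ub.
by exists (criterion M beta gamma x (stationary u)), (stationary u).
Qed.

(** The function of the action that [bellman_policy] maximises at time 0 when
    gamma is nonzero. *)
Definition risk_objective gamma x a : R :=
  reward M x a + gamma^-1 *
    ln (\sum_y expR (gamma * beta * value M beta y (gamma * beta)) * trans M a x y).

(** Two errors add up, both at risk parameter d = gamma beta: replacing the
    certainty equivalent of the next value by its mean (8 |d| D^2, since the
    risk-sensitive value is only known to be bounded by 2 D), and replacing
    that value by v (2 |d| D^2). *)
Lemma risk_objective_dist gamma x a : gamma != 0 -> `|gamma| * D <= 1 / 4 ->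
  `|risk_objective gamma x a - bellman_objective M beta v x a|
    <= 10 * `|gamma| * D ^+ 2.
Proof.
move=> g0 gD; case/andP: (beta01) => bgt0 blt1.
have D0 : 0 <= D by exact: le_trans (normr_ge0 _) (vD x).
set d := gamma * beta; have d0 : d != 0 by rewrite mulf_neq0 // gt_eqF.
have dE : `|d| = beta * `|gamma| by rewrite normrM (ger0_norm b0) mulrC.
have d_le : `|d| <= `|gamma| by rewrite dE ger_pMl ?normr_gt0 // ltW.
have dD : `|d| * D <= 1 / 4 by apply: le_trans gD; rewrite ler_wpM2r.
set W := value M beta ^~ d.
have Wv y : `|W y - v y| <= 2 * `|d| * D ^+ 2 by apply: value_dist => //; lra.
have W2D y : `|W y| <= 2 * D.
  have -> : W y = (W y - v y) + v y by rewrite subrK.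
  apply: le_trans (ler_normD _ _) _; apply: le_trans (lerD (Wv y) (vD y)) _.
  have := ler_wpM2r D0 dD; lra.
have ce := certainty_equivalent_sum (trans_ge0 M a x) (trans_sum1 M a x) W2D d0
  ltac:(lra).
set L := ln _ in ce; set m := \sum_i _ in ce.
have mv : `|m - \sum_y v y * trans M a x y| <= 2 * `|d| * D ^+ 2.
  rewrite -sumrB; apply: le_trans (ler_norm_sum _ _ _) _.
  rewrite -[leRHS]mulr1 -[X in _ * X](trans_sum1 M a x) mulr_sumr; apply: ler_sum => y _.
  by rewrite -mulrBl normrM (ger0_norm (trans_ge0 _ _ _ _)) ler_wpM2r ?trans_ge0 ?Wv.
have -> : risk_objective gamma x a - bellman_objective M beta v x a =
    beta * ((d^-1 * L - m) + (m - \sum_y v y * trans M a x y)).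
  rewrite /risk_objective /bellman_objective -/d.
  have -> : \sum_y beta * v y * trans M a x y = beta * \sum_y v y * trans M a x y.
    by rewrite mulr_sumr; apply: eq_bigr => y _; rewrite mulrA.
  have -> : gamma^-1 = beta * d^-1.
    by rewrite /d; field; rewrite g0 gt_eqF.
  by rewrite /L; ring.
rewrite normrM (ger0_norm b0).
have tri := le_trans (ler_normD _ _) (lerD ce mv).
apply: (le_trans (ler_wpM2l b0 tri)).
have h : 0 <= `|d| * D ^+ 2 by rewrite mulr_ge0 ?sqr_ge0.
apply: (@le_trans _ _ (10 * (`|d| * D ^+ 2))).
  by have := ler_wpM2r h (ltW blt1); lra.
by rewrite -mulrA ler_wpM2l // ler_wpM2r ?sqr_ge0.
Qed.

(** * Stability of the maximisers *)

(** Two objectives move by at most 10 |gamma| D^2 each, so their order cannot be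
    reversed while 20 |gamma| D^2 stays below the least positive gap. *)
Lemma bellman_policy_greedy : exists2 gamma0 : R, gamma0 < 0 &
  forall gamma, gamma0 <= gamma <= 0 ->
    greedy M beta v (bellman_policy M beta gamma 0).
Proof.
have [g g0 gap] := fin_positive_lower_bound (fun p : E * U * U =>
  bellman_objective M beta v p.1.1 p.2 - bellman_objective M beta v p.1.1 p.1.2).
(* The condition |gamma| K <= 1 yields both |gamma| D <= 1/4 and
   20 |gamma| D^2 <= g / 2; D + 1 replaces D to keep K positive. *)
pose K := 40 * (D + 1) ^+ 2 / g + 4 * (D + 1).
have D0 : 0 <= D by exact: le_trans (normr_ge0 _) (vD (some_state M)).
have K0 : 0 < K.
  by rewrite ltr_wpDl ?mulr_ge0 ?invr_ge0 ?sqr_ge0 ?(ltW g0) //; lra.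
exists (- K^-1); first by rewrite oppr_lt0 invr_gt0.
move=> gamma /andP[gK gle0] x b; rewrite /bellman_policy.
set F := (X in first_argmax _ X); set a := first_argmax _ F.
have Fa : F b <= F a by exact: first_argmax_ge.
case: (eqVneq gamma 0) Fa => [ge0|gn0] Fa.
  have FE c : F c = bellman_objective M beta v x c.
    rewrite /F ge0 eqxx; congr (_ + _); apply: eq_bigr => y _.
    by rewrite value0_solution.
  by rewrite -!FE.
have FE c : F c = risk_objective gamma x c.
  by rewrite /F (negbTE gn0) /risk_objective expr0 expr1 mulr1.
have gN : `|gamma| * K <= 1.
  by rewrite -ler_pdivlMr // div1r ler0_norm // lerNl.
have [g1 g2] : `|gamma| * D <= 1 / 4 /\ 20 * `|gamma| * D ^+ 2 < g.
  have n0 : 0 < `|gamma| by rewrite normr_gt0.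
  have q0 : 0 <= `|gamma| * (D + 1) by rewrite mulr_ge0 //; lra.
  have q1 : 0 <= `|gamma| * (40 * (D + 1) ^+ 2 / g).
    by rewrite mulr_ge0 // divr_ge0 ?(ltW g0) // mulr_ge0 ?sqr_ge0.
  move: gN; rewrite /K mulrDr => gN; split; first by lra.
  have : `|gamma| * (40 * (D + 1) ^+ 2 / g) <= 1 by lra.
  rewrite mulrA ler_pdivrMr // mul1r => h.
  have : `|gamma| * D ^+ 2 <= `|gamma| * (D + 1) ^+ 2.
    rewrite ler_wpM2l // (_ : (D + 1) ^+ 2 = D ^+ 2 + (2 * D + 1)); last by ring.
    by rewrite lerDl; lra.
  by lra.
rewrite leNgt; apply/negP => lt_ab.
have := gap (x, a, b); rewrite /= subr_gt0 => /(_ lt_ab).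
have := risk_objective_dist x a gn0 g1; have := risk_objective_dist x b gn0 g1.
rewrite -!FE !ler_norml => /andP[? ?] /andP[? ?].
by lra.
Qed.

End discounted_reward.

Theorem theorem6p6 (R : realType) (E U : finType) (M : mdp R E U)
    (hA1 : assumption_A1 M) (hA2 : assumption_A2 M)
    (beta : R) (hbeta : 0 < beta < 1) :
  exists gamma0 : R, gamma0 < 0 /\
    forall gamma : R, gamma0 <= gamma <= 0 ->
      optimal M beta 0 (stationary (bellman_policy M beta gamma 0)).
Proof.
pose C := \sum_(p : E * U) `|reward M p.1 p.2|.
have rewardD x a : `|reward M x a| <= (1 - beta) * (C / (1 - beta)).
  rewrite mulrC divfK; last by case/andP: hbeta => _ ?; lra.
  by rewrite /C (bigD1 (x, a)) //= lerDl sumr_ge0.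
have [v [v_sol vD]] := bellman_solution_exists hbeta rewardD.
have [gamma0 gamma0_lt0 hg] := bellman_policy_greedy hbeta rewardD v_sol vD.
exists gamma0; split=> // gamma gammaP.
apply: (greedy_optimal hbeta rewardD v_sol vD); exact: hg.
Qed.
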